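(* Let $Z$ be a standard Borel space and let $A\subseteq Z\times H$ be a Borel set such that the following hold. (1) For every $z\in Z$, the section $A_z$ is non-empty and compact. (2) For every $z\in Z$, the section $A_z$ is norm separable. Then there exists a sequence $(f_n)$ of Borel selectors of $A$ such that for all $z\in Z$ the sequence $\big(f_n(z)\big)$ is norm dense in $A_z$.
   Context: $H=[-1,1]^{\mathbb{N}}$ is equipped with the product topology; compactness in $H$ and Borel sets of $H$ refer to this topology. A subset $S$ of $H$ is called norm separable if it is separable with respect to the metric induced by the supremum norm $\|\cdot\|_\infty$; norm dense means dense with respect to this metric. For $A\subseteq Z\times H$ and $z\in Z$, $A_z=\{f\in H:(z,f)\in A\}$. A map $f:Z\to H$ is a Borel selector of $A$ if $f$ is a Borel map with $(z,f(z))\in A$ for every $z\in Z$. *)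

(* Defs.v *)
From HB Require Import structures.
From mathcomp Require Import all_boot all_order all_algebra.
From mathcomp Require Import all_classical all_reals all_analysis.

Set Implicit Arguments.
Unset Strict Implicit.
Unset Printing Implicit Defensive.

Import Order.TTheory GRing.Theory Num.Theory.
Import numFieldNormedType.Exports.

Local Open Scope classical_set_scope.
Local Open Scope ring_scope.

(* [T] equipped with its Borel sigma-algebra; same carrier as [T]. *)
Notation borel T := (g_sigma_algebraType (@open T)).

#[short(type="completeMetricType")]
HB.structure Definition CompleteMetric (R : numDomainType) :=
  {T of CompletePseudoMetric R T & Metric R T}.

Definition separable (T : topologicalType) : Prop :=
  exists2 D : set T, countable D & dense D.

(* Isomorphic, as a measurable space, to a Polish space with its Borel
   sets. [R] is only the field in which the metric takes its values. *)
Definition standard_borel (R : realType) (d : measure_display)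
    (Z : measurableType d) : Prop :=
  exists (P : completeMetricType R) (phi : Z -> P) (psi : P -> Z),
    [/\ separable P,
        cancel phi psi,
        cancel psi phi,
        measurable_fun [set: Z] (phi : Z -> borel P) &
        measurable_fun [set: borel P] (psi : borel P -> Z)].

(* [-1, 1]^nat with the product topology *)
Definition cube (R : realType) : Type :=
  {ptws nat -> (`[-1 : R, 1]%classic : Type)}.

HB.instance Definition _ (R : realType) :=
  PseudoMetric.copy (cube R) {ptws nat -> (`[-1 : R, 1]%classic : Type)}.

Fact itvN11_0 (R : realType) : (0 : R) \in (`[-1, 1]%classic : set R).
Proof. by rewrite inE /= in_itv /= oppr_le0 ler01. Qed.

HB.instance Definition _ (R : realType) :=
  isPointed.Build (cube R) (fun=> exist _ 0 (itvN11_0 R)).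

Definition supdist (R : realType) (f g : cube R) : R :=
  sup (range (fun n => `|set_val (f n) - set_val (g n)|)).

(* [D] is a subset of [S], dense in [S] for the metric [supdist]. *)
Definition norm_dense_in (R : realType) (S D : set (cube R)) : Prop :=
  D `<=` S /\
  forall f, S f -> forall e : R, 0 < e -> exists2 g, D g & supdist f g < e.

Definition norm_separable (R : realType) (S : set (cube R)) : Prop :=
  exists2 D, countable D & norm_dense_in S D.

Definition borel_selector (R : realType) (d : measure_display)
    (Z : measurableType d) (A : set (Z * cube R)) (f : Z -> cube R) : Prop :=
  measurable_fun [set: Z] (f : Z -> borel (cube R)) /\ forall z, A (z, f z).

(* Main.v *)
Require Import Defs.
From mathcomp Require Import all_boot all_order all_algebra.
From mathcomp Require Import all_classical all_reals all_analysis.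
From mathcomp Require Import lra.

Set Implicit Arguments.
Unset Strict Implicit.
Unset Printing Implicit Defensive.

Import Order.TTheory GRing.Theory Num.Theory.
Import numFieldNormedType.Exports.

Local Open Scope classical_set_scope.
Local Open Scope ring_scope.

(** Fix [e > 0].  It suffices to cover [A] by countably many Borel sets with
closed sections, contained in [A], whose sections have norm diameter at most
[e]: each piece has a Borel selector over its (Borel) projection, which is
completed by a selector of [A] elsewhere, and letting [e] run through
[1 / (k + 1)] these selectors are norm dense in every section.

The cover comes from a tree argument.  Two points of the cube at norm distance
more than [e] are separated by a gap: a coordinate [n] and rationals
[p + e <= q] with one point in [x_n < p] and the other in [q < x_n].  A finite
list of half-spaces [x_n <= p], [q <= x_n] cuts out a cell, and splitting a
cell along a gap gives two cells at distance at least [e].  If at some [z]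
there is an infinite binary tree of cells, each split into two by a gap and
each meeting [A_z], then [A_z] is not norm separable: given a candidate
countable dense set, follow at level [n] the child that stays [e / 2] away from
its [n]-th member, and compactness gives a point of [A_z] in all the cells of
the branch ([norm_separable_no_scheme]).  So there is no such tree at any [z].
Now say that a finite list of cells is good over [W] when [W] is covered by
Borel sets, one for each cell, over which the part of [A] inside that cell has
a cover of the required kind.  If all the splittings of a cell are good, so is
the cell ([good_split]): what the pieces inside the children leave out is a
Borel set with closed sections containing no two points separated by a gap.
If the root cell were not good, dependent choice would produce a tree of cells
that is nowhere good, together with a code of a single point [z] at which
all the cells are met, which was excluded ([exists_scheme]).  This replaces the
transfinite derivative of a norm separable compact set, and the argument that
its rank is bounded uniformly in [z].

For the tree argument and for the selectors, the set of the [z] at which [A]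
meets a given closed set has to be Borel, that is, the projection of a Borel
set with compact sections is Borel ([measurable_proj]).  The complement of such
a set has open sections, and it is a countable union of products of a Borel set
with an open set ([closed_sections_compl]); compactness of the cube then
expresses the complement of the projection by countable operations.  That
decomposition follows from the separation theorems of Novikov and Lusin for
analytic sets ([novikov_separation], [lusin_separation]).

Analytic sets are images of closed subsets of the Baire space under maps that
are continuous for finer and finer Polish topologies.  As only countably many
Borel sets are involved at any time, it is enough to know that countably many
Borel sets of a standard Borel space can be made clopen simultaneously by such
a parametrization ([souslin]). *)

(** * Closed subsets of the Baire space *)

Notation baire := (nat -> nat).

Definition agree (n : nat) (b c : baire) := forall i, (i < n)%N -> b i = c i.

Lemma agree_sym n b c : agree n b c -> agree n c b.
Proof. by move=> bc i /bc. Qed.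

Lemma agree_trans n b c d : agree n b c -> agree n c d -> agree n b d.
Proof. by move=> bc cd i ni; rewrite bc// cd. Qed.

Lemma agree_le m n b c : (m <= n)%N -> agree n b c -> agree m b c.
Proof. by move=> mn bc i im; apply: bc; exact: leq_trans mn. Qed.

(** Closedness for the product of the discrete topologies, phrased with initial
segments so that limits of codes can be handled coordinatewise. *)
Definition bclosed (C : set baire) :=
  forall b, (forall n, exists2 c, C c & agree n b c) -> C b.

Definition bcontinuous (phi : baire -> baire) :=
  forall n, exists m, forall b c, agree m b c -> agree n (phi b) (phi c).

Lemma bclosed0 : bclosed set0.
Proof. by move=> b /(_ 0%N)[c []]. Qed.

Lemma bclosed_bigcap I (D : set I) (C : I -> set baire) :
  (forall i, D i -> bclosed (C i)) -> bclosed (\bigcap_(i in D) C i).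
Proof.
move=> cC b hb i Di; apply: cC => // n.
by have [c /(_ i Di) Cc bc] := hb n; exists c.
Qed.

Lemma bclosedI C D : bclosed C -> bclosed D -> bclosed (C `&` D).
Proof.
move=> cC cD b hb; split.
- by apply: cC => n; have [c [Cc _] bc] := hb n; exists c.
- by apply: cD => n; have [c [_ Dc] bc] := hb n; exists c.
Qed.

Lemma bclosed_preimage phi C :
  bcontinuous phi -> bclosed C -> bclosed (phi @^-1` C).
Proof.
move=> cphi cC b hb; apply: cC => n; have [m hm] := cphi n.
by have [c Cc bc] := hb m; exists (phi c) => //; exact: hm.
Qed.

Lemma bclosed_approx C b : bclosed C -> ~ C b ->
  exists n, forall c, agree n b c -> ~ C c.
Proof.
move=> cC nCb; apply: contrapT => /forallNP hn; apply: nCb; apply: cC => n.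
by have /existsNP[c /not_implyP[bc /contrapT Cc]] := hn n; exists c.
Qed.

Definition btail (b : baire) : baire := fun n => b n.+1.
Definition bcons (k : nat) (b : baire) : baire :=
  fun n => if n is m.+1 then b m else k.

Lemma bclosed_cons (C : nat -> set baire) : (forall k, bclosed (C k)) ->
  bclosed [set b | C (b 0%N) (btail b)].
Proof.
move=> cC b hb; apply: cC => n; have [c /= Cc bc] := hb n.+1.
exists (btail c) => [|i ni]; first by rewrite (bc 0%N).
exact: bc.
Qed.

(** A single code carries countably many codes, which [bmerge] packs and [bcomp]
reads back. *)
Definition bcomp (k : nat) (b : baire) : baire := fun n => b (pickle (k, n)).
Definition bmerge (f : nat -> baire) : baire :=
  fun n => if unpickle n is Some (k, i) then f k i else 0%N.

Lemma bmergeK f k : bcomp k (bmerge f) = f k.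
Proof. by apply/funext => n; rewrite /bcomp /bmerge pickleK. Qed.

Lemma bcontinuous_comp k : bcontinuous (bcomp k).
Proof.
move=> n; exists (\max_(i < n) pickle (k, nat_of_ord i)).+1 => b c bc i ni.
by apply: bc; rewrite ltnS (leq_bigmax (Ordinal ni)).
Qed.

(** * Parametrizations by the Baire space *)

(** The members of [F] act as closed sets of a topology on [X]: the parametrization
is required to be continuous for it.  When [F] contains a set together with its
complement, membership in that set is decided by a finite part of the code. *)
Definition coded (X : Type) (S : set X) (F : set (set X)) :=
  exists (C : set baire) (h : baire -> X),
    [/\ bclosed C, h @` C = S &
        forall A, F A -> bclosed (C `&` h @^-1` A)].

(** This is the Hausdorff property, in terms of closed sets. *)
Definition separating (X : Type) (F : set (set X)) :=
  forall x y, x <> y ->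
    exists A B, [/\ F A, F B, A `|` B = setT, ~ A x & ~ B y].

Section coded.
Context {X : Type}.
Implicit Types (S A : set X) (F G : set (set X)).

Lemma sub_coded S F G : F `<=` G -> coded S G -> coded S F.
Proof. by move=> FG [C [h [cC hC hG]]]; exists C, h; split=> // A /FG/hG. Qed.

(** Restricting the parametrization to the codes of points of [A] keeps its domain
closed, because [A] is one of the sets of [F]. *)
Lemma coded_setI S A F : F A -> coded S F -> coded (S `&` A) F.
Proof.
move=> FA [C [h [cC hC hF]]]; exists (C `&` h @^-1` A), h; split.
- exact: hF.
- rewrite -hC; apply/seteqP; split=> [_ [b [Cb Ab] <-]|x [[b Cb <-] Ab]].
    by split=> //; exists b.
  by exists b.
- move=> B FB; have -> : C `&` h @^-1` A `&` h @^-1` B =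
      (C `&` h @^-1` B) `&` (C `&` h @^-1` A).
    by apply/seteqP; split=> b /= [] => [[Cb Ab] Bb|[Cb Bb] [_ Ab]].
  exact: bclosedI (hF _ FB) (hF _ FA).
Qed.

Lemma coded_image Y (g : X -> Y) S (F : set (set Y)) :
  coded S [set g @^-1` A | A in F] -> coded (g @` S) F.
Proof.
move=> [C [h [cC <- hF]]]; exists C, (g \o h); split=> //.
- by rewrite image_comp.
- by move=> A FA; apply: (hF (g @^-1` A)); exists A.
Qed.

(** A point is coded by a sequence of codes of it, one for each of the given
parametrizations.  That all of them code the same point is a closed condition,
because two distinct points are told apart by [G] at a finite stage. *)
Lemma coded_bigcup (F : nat -> set (set X)) G :
  (forall k, coded setT (F k)) -> (forall k, G `<=` F k) -> separating G ->
  coded setT (\bigcup_k F k).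
Proof.
move=> cF GF sepG; have [C hC] := choice cF; have [h {}hC] := choice hC.
pose h0 b := h 0%N (bcomp 0 b).
pose D := \bigcap_k (bcomp k @^-1` C k) `&`
  [set b | forall k, h k (bcomp k b) = h0 b].
have cF' k A : F k A -> bclosed (bcomp k @^-1` (C k `&` h k @^-1` A)).
  move=> FA; apply: bclosed_preimage; first exact: bcontinuous_comp.
  by have [_ _] := hC k; apply.
have cC : bclosed (\bigcap_k (bcomp k @^-1` C k)).
  apply: bclosed_bigcap => k _; apply: bclosed_preimage; last by case: (hC k).
  exact: bcontinuous_comp.
have cD : bclosed D.
  move=> b hb; have Cb : (\bigcap_k (bcomp k @^-1` C k)) b.
    by apply: cC => n; have [c [Dc _] bc] := hb n; exists c.
  split=> // k; apply: contrapT => /sepG[A [B [GA GB AB nA nB]]].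
  have [n hn] : exists n, forall c, agree n b c ->
      ~ (bcomp k @^-1` (C k `&` h k @^-1` A)) c.
    by apply: bclosed_approx; [exact/cF'/GF | case].
  have [m hm] : exists n, forall c, agree n b c ->
      ~ (bcomp 0 @^-1` (C 0%N `&` h 0%N @^-1` B)) c.
    by apply: bclosed_approx; [exact/cF'/GF | case].
  have [c [Cc hc] bc] := hb (maxn n m).
  have : (A `|` B) (h0 c) by rewrite AB.
  case=> [Ac|Bc].
  - apply: (hn c); first by apply: agree_le bc; rewrite leq_maxl.
    by split; [exact: Cc | rewrite /= hc].
  - apply: (hm c); first by apply: agree_le bc; rewrite leq_maxr.
    by split; [exact: Cc | ].
exists D, h0; split=> //.
- apply/seteqP; split=> // x _.
  have /choice[f hf] : forall k, exists b, C k b /\ h k b = x.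
    by move=> k; have [_ hT _] := hC k; have : [set: X] x by []; rewrite -hT;
      case=> b Cb <-; exists b.
  exists (bmerge f); last by rewrite /h0 bmergeK; case: (hf 0%N).
  split=> [k _|k]; rewrite /h0 /= !bmergeK; first by case: (hf k).
  by case: (hf k) => _ ->; case: (hf 0%N).
- move=> A [k _ FA].
  have -> : D `&` h0 @^-1` A =
      D `&` bcomp k @^-1` (C k `&` h k @^-1` A).
    apply/seteqP; split=> b [Db] => [Ab|[_ Ab]]; split=> //.
    - by split; [case: Db => /(_ k I) | case: Db => _ hb; rewrite /= hb].
    - by case: Db => _ hb; rewrite /= -(hb k).
  by apply: bclosedI => //; exact: cF'.
Qed.

(** The first digit of the new code says either that the point is in [B] or names
some [A k] containing it; so an open set presented as a union of closed ones
becomes clopen. *)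
Lemma coded_witness F (A : nat -> set X) B :
  coded setT F -> (forall k, F (A k)) -> F B -> \bigcup_k A k = ~` B ->
  coded setT (F `|` [set ~` B]).
Proof.
move=> [C [h [cC hT hF]]] FA FB AB.
pose E k := C `&` h @^-1` (if k is k'.+1 then A k' else B).
pose h' b := h (btail b).
have cE : bclosed [set b | E (b 0%N) (btail b)].
  by apply: bclosed_cons => -[|k]; exact: hF.
exists [set b | E (b 0%N) (btail b)], h'; split=> //.
- apply/seteqP; split=> // x _.
  have [b Cb hb] : (h @` C) x by rewrite hT.
  have [Bx|] := pselect (B x).
    by exists (bcons 0 b) => //; split=> //=; rewrite hb.
  rewrite -[~ B x]/((~` B) x) -AB => -[k _ Ax].
  by exists (bcons k.+1 b) => //; split=> //=; rewrite hb.
- move=> D [FD|->].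
    have -> : [set b | E (b 0%N) (btail b)] `&` h' @^-1` D =
        [set b | (E (b 0%N) `&` (C `&` h @^-1` D)) (btail b)].
      by apply/seteqP; split=> b /= [] => [[Cb Eb] Db|[Cb Eb] [_ Db]].
    apply: (@bclosed_cons (fun k => E k `&` (C `&` h @^-1` D))) => k.
    by apply: bclosedI; [case: k => [|k] |]; exact: hF.
  have -> : [set b | E (b 0%N) (btail b)] `&` h' @^-1` (~` B) =
      [set b | (if b 0%N is k.+1 then E k.+1 else set0) (btail b)].
    apply/seteqP; split=> b /=; case: (b 0%N) => [|k] //=.
    - by move=> [[]].
    - by move=> [].
    - move=> [Cb Ab]; split=> //; rewrite -[~ _]/((~` B) (h' b)) -AB.
      by exists k.
  by apply: (@bclosed_cons (fun k => if k is k'.+1 then E k'.+1 else set0))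
    => -[|k]; [exact: bclosed0 | exact: hF].
Qed.

(** The sets that can be made clopen without losing the closed sets of [G].  For a
countable union, first make all its members clopen by [coded_bigcup]: the
complement of the union is then closed, and [coded_witness] applies. *)
Lemma coded_sigma_algebra G : coded setT G -> separating G ->
  sigma_algebra setT [set M | coded setT (G `|` [set M; ~` M])].
Proof.
move=> cG sepG; split=> /=.
- case: cG => [C [h [cC hT hG]]]; exists C, h; split=> // A [/hG//|[->|->]].
    by rewrite preimage_set0 setI0; exact: bclosed0.
  by rewrite setC0 preimage_setT setIT.
- by move=> M; rewrite setTD setCK [X in _ `|` X]setUC.
- move=> M cM.
  have := coded_bigcup cM (fun k => @subsetUl _ _ _) sepG.
  set F := \bigcup_k _ => cF.
  have cF' : coded setT (F `|` [set ~` \bigcup_k M k]).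
    case: cF => [C [h [cC hT hF]]]; exists C, h; split=> // A [/hF//|->].
    rewrite setC_bigcup preimage_bigcap setIC -bigcapIl; last by exists 0%N.
    apply: bclosed_bigcap => k _; rewrite setIC; apply: hF.
    by exists k => //; right; right.
  have := @coded_witness _ M (~` \bigcup_k M k) cF'.
  rewrite setCK => cw; apply: (sub_coded _ (cw _ _ _)) => //.
  + by move=> A [GA|[->|->]]; [do 2 left; exists 0%N; [|left] | right |
      left; right].
  + by move=> k; left; exists k => //; right; left.
  + by right.
Qed.

End coded.

Lemma coded_prod X Y (F : set (set X)) (G : set (set Y)) :
  coded setT F -> coded setT G ->
  coded [set: X * Y] ([set fst @^-1` A | A in F] `|` [set snd @^-1` B | B in G]).
Proof.
move=> [C [h [cC hT hF]]] [D [g [cD gT gG]]].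
exists (bcomp 0 @^-1` C `&` bcomp 1 @^-1` D),
  (fun b => (h (bcomp 0 b), g (bcomp 1 b))).
have pcl k E : bclosed E -> bclosed (bcomp k @^-1` E).
  by apply: bclosed_preimage; exact: bcontinuous_comp.
split.
- by apply: bclosedI; exact: pcl.
- apply/seteqP; split=> // -[x y] _.
  have [b Cb hb] : (h @` C) x by rewrite hT.
  have [c Dc gc] : (g @` D) y by rewrite gT.
  exists (bmerge (fun k => if k == 0%N then b else c)) => /=.
    by rewrite !bmergeK.
  by rewrite !bmergeK /= hb gc.
- move=> _ [[A FA <-]|[B GB <-]].
  + set U := (X in bclosed X).
    have -> : U = bcomp 0 @^-1` (C `&` h @^-1` A) `&` bcomp 1 @^-1` D.
      by apply/seteqP; split=> b /= [] [].
    by apply: bclosedI; apply: pcl => //; exact: hF.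
  + set U := (X in bclosed X).
    have -> : U = bcomp 0 @^-1` C `&` bcomp 1 @^-1` (D `&` g @^-1` B).
      by apply/seteqP; split=> b /= [] => [[]|? []].
    by apply: bclosedI; apply: pcl => //; exact: gG.
Qed.

(** * Analytic sets *)

Lemma countableU (U : Type) (F G : set U) :
  countable F -> countable G -> countable (F `|` G).
Proof.
move=> cF cG; rewrite -bigcup2E; apply: bigcup_countable => // -[|[|n]] _ //=.
Qed.

Lemma countable_image (U V : Type) (f : U -> V) (F : set U) :
  countable F -> countable (f @` F).
Proof. by apply: card_le_trans; exact: card_image_le. Qed.

Lemma countable_sub_range (U : choiceType) (u0 : U) (F : set U) :
  countable F -> exists e : nat -> U, F `<=` range e.
Proof.
move=> /countable_injP[f finj].
exists (fun n => xget u0 [set A | F A /\ f A = n]) => A FA.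
exists (f A) => //; case: xgetP => [B -> [FB fBA]|/(_ A)[]//].
by apply: finj => //; rewrite inE.
Qed.

Lemma measurable_preimageT d d' (X : measurableType d) (Y : measurableType d')
    (f : X -> Y) (A : set Y) :
  measurable_fun setT f -> measurable A -> measurable (f @^-1` A).
Proof. by move=> mf mA; rewrite -[_ @^-1` _]setTI; exact: mf. Qed.

Definition countably_separated d (X : measurableType d) :=
  exists G : nat -> set X, (forall n, measurable (G n)) /\
    forall x y, x <> y -> exists n, G n x /\ ~ G n y.

(** For a standard Borel [X] these are the usual analytic sets.  Allowing every
countable family [F] means that the parametrization can be made continuous for
a Polish topology that refines the given one and makes [F] clopen. *)
Definition analytic d (X : measurableType d) (S : set X) :=
  forall F : set (set X), countable F -> F `<=` measurable -> coded S F.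

Definition souslin d (X : measurableType d) :=
  countably_separated X /\ analytic [set: X].

Lemma countably_separated_family d (X : measurableType d) :
  countably_separated X ->
  exists F : set (set X), [/\ countable F, F `<=` measurable & separating F].
Proof.
move=> [G [mG sepG]].
exists (range G `|` range (fun n => ~` G n)); split.
- by apply: countableU; exact: countable_image.
- by move=> _ [[n _ <-]|[n _ <-]]; [|apply: measurableC].
- move=> x y /nesym/sepG[n [Gny nGnx]]; exists (G n), (~` G n); split=> //.
  + by left; exists n.
  + by right; exists n.
  + by rewrite setUCr.
Qed.

Lemma analytic_setI d (X : measurableType d) (S A : set X) :
  analytic S -> measurable A -> analytic (S `&` A).
Proof.
move=> aS mA F cF mF.
apply: (@sub_coded _ _ F (F `|` [set A])) => [B FB|]; first by left.
apply: coded_setI; first by right.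
apply: aS; first exact: countableU.
by move=> B [/mF//|->].
Qed.

Lemma measurable_analytic d (X : measurableType d) (A : set X) :
  souslin X -> measurable A -> analytic A.
Proof. by move=> [_ aX] mA; rewrite -[A]setTI; exact: analytic_setI. Qed.

(** Continuity of [g] comes for free: the preimages under [g] of the sets of [F]
are measurable, so they can be prescribed in the parametrization of [S]. *)
Lemma analytic_image d d' (X : measurableType d) (Y : measurableType d')
    (g : X -> Y) (S : set X) :
  measurable_fun setT g -> analytic S -> analytic (g @` S).
Proof.
move=> mg aS F cF mF; apply: coded_image; apply: aS.
- exact: countable_image.
- by move=> _ [A /mF mA <-]; exact: measurable_preimageT.
Qed.

(** Each of countably many measurable sets has a parametrization that makes it
clopen, and [coded_bigcup] amalgamates these. *)
Lemma souslin_generated d (X : measurableType d) (G : set (set X)) :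
  countably_separated X -> coded setT G -> separating G ->
  measurable `<=` [set M | coded setT (G `|` [set M; ~` M])] -> souslin X.
Proof.
move=> sX cG sepG mX; split=> // F cF mF.
have [e Fe] := countable_sub_range set0 cF.
pose e' n := if `[< F (e n) >] then e n else set0.
have := @coded_bigcup _ (fun n => G `|` [set e' n; ~` e' n]) G.
move=> /(_ _ (fun k => @subsetUl _ _ _) sepG) cU.
apply: sub_coded (cU _) => [A FA|n].
- have [n _ en] := Fe _ FA; exists n => //; right; left.
  by rewrite /e' en; case: asboolP.
- by apply: mX; rewrite /e'; case: asboolP => [/mF//|_]; exact: measurable0.
Qed.

Lemma souslin_isomorphic d d' (X : measurableType d) (Y : measurableType d')
    (phi : Y -> X) (psi : X -> Y) :
  measurable_fun setT phi -> measurable_fun setT psi -> cancel phi psi ->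
  souslin X -> souslin Y.
Proof.
move=> mphi mpsi phiK [[G [mG sepG]] aX]; split.
- exists (fun n => phi @^-1` G n); split=> [n|x y xy].
    exact: measurable_preimageT.
  by apply: sepG => /(congr1 psi); rewrite !phiK.
- have -> : [set: Y] = psi @` setT; last exact: analytic_image.
  by apply/seteqP; split=> // y _; exists (phi y).
Qed.

(** The family [H] of the cylinders over separating families is separating on the
product, and a cylinder over a measurable set is made clopen by a product of
parametrizations; the cylinders generate the measurable sets of the product. *)
Lemma souslin_prod d1 d2 (X : measurableType d1) (Y : measurableType d2) :
  souslin X -> souslin Y -> souslin (X * Y)%type.
Proof.
move=> [sX aX] [sY aY].
have [F [cF mF sepF]] := countably_separated_family sX.
have [G [cG mG sepG]] := countably_separated_family sY.
pose H := [set fst @^-1` A | A in F] `|` [set snd @^-1` B | B in G] :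
  set (set (X * Y)).
have sepH : separating H.
  move=> [x y] [x' y'] xy; have [xx'|xx'] := pselect (x = x').
  - have yy' : y <> y' by move=> yy'; apply: xy; rewrite xx' yy'.
    have [A [B [GA GB AB nA nB]]] := sepG _ _ yy'.
    exists (snd @^-1` A), (snd @^-1` B); split=> //.
    + by right; exists A.
    + by right; exists B.
    + by rewrite -preimage_setU AB.
  - have [A [B [FA FB AB nA nB]]] := sepF _ _ xx'.
    exists (fst @^-1` A), (fst @^-1` B); split=> //.
    + by left; exists A.
    + by left; exists B.
    + by rewrite -preimage_setU AB.
have cH : coded setT H by apply: coded_prod; [exact: aX | exact: aY].
have cfst A : measurable A ->
    coded [set: X * Y] (H `|` [set fst @^-1` A; ~` (fst @^-1` A)]).
  move=> mA; apply: sub_coded (coded_prod (aX (F `|` [set A; ~` A]) _ _)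
    (aY G _ _)) => //.
  + move=> _ [[[B FB <-]|[B GB <-]]|[->|->]].
    * by left; exists B => //; left.
    * by right; exists B.
    * by left; exists A => //; right; left.
    * by left; exists (~` A) => //; right; right.
  + by apply: countableU => //; exact: countableU.
  + by move=> _ [/mF//|[->|->]] //; exact: measurableC.
have csnd A : measurable A ->
    coded [set: X * Y] (H `|` [set snd @^-1` A; ~` (snd @^-1` A)]).
  move=> mA; apply: sub_coded (coded_prod (aX F _ _)
    (aY (G `|` [set A; ~` A]) _ _)) => //.
  + move=> _ [[[B FB <-]|[B GB <-]]|[->|->]].
    * by left; exists B.
    * by right; exists B => //; left.
    * by right; exists A => //; right; left.
    * by right; exists (~` A) => //; right; right.
  + by apply: countableU => //; exact: countableU.
  + by move=> _ [/mG//|[->|->]] //; exact: measurableC.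
apply: (@souslin_generated _ _ H) => //.
- case: sX sY => [A [mA sepA]] [B [mB sepB]].
  exists (fun n => if odd n then fst @^-1` A n./2 else snd @^-1` B n./2).
  split=> [n|[x y] [x' y'] xy].
    case: ifP => _; apply: measurable_preimageT => //.
  have [xx'|/sepA[n An]] := pselect (x = x').
    have /sepB[n Bn] : y <> y' by move=> yy'; apply: xy; rewrite xx' yy'.
    by exists n.*2; rewrite odd_double doubleK.
  by exists n.*2.+1; rewrite /= odd_double /= uphalf_double.
- rewrite [X in X `<=` _](_ : _ = <<s
     preimage_set_system setT fst (@measurable _ X) `|`
     preimage_set_system setT snd (@measurable _ Y) >>) //.
  apply: smallest_sub; first exact: coded_sigma_algebra.
  move=> _ [[A mA <-]|[B mB <-]] /=; rewrite setTI; [exact: cfst|exact: csnd].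
Qed.

(** * Separation theorems *)

Section novikov.
Context d (X : measurableType d) (C : nat -> set baire) (h : nat -> baire -> X).

Let piece (b : nat -> baire) (l : nat -> nat) k : set X :=
  h k @` (C k `&` [set c | agree (l k) (b k) c]).

Let separated (P : nat -> set X) := exists Q : nat -> set X,
  [/\ forall k, measurable (Q k), forall k, P k `<=` Q k & \bigcap_k Q k = set0].

(** Lengthening by one digit the segment that defines the [k]-th piece: if the
families obtained for all values [i] of this digit are separated, take the union
of the hulls in position [k] and their intersection in the other positions. *)
Let step_one b l k : ~ separated (piece b l) ->
  exists2 b', (forall j, agree (l j) (b j) (b' j)) &
    ~ separated (piece b' (fun j => if j == k then (l j).+1 else l j)).
Proof.
move=> nsep; pose b' i j n := if (j == k) && (n == l k) then i else b j n.
have bb' i j : agree (l j) (b j) (b' i j).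
  move=> n nl; rewrite /b'; case: eqP => //= jk; case: eqP => // nlk.
  by move: nl; rewrite nlk jk ltnn.
apply: contrapT => hN; apply: nsep.
have /choice[Q hQ] : forall i, separated
    (piece (b' i) (fun j => if j == k then (l j).+1 else l j)).
  move=> i; apply: contrapT => ns.
  by apply: hN; exists (b' i).
exists (fun j => if j == k then \bigcup_i Q i j else \bigcap_i Q i j); split.
- move=> j; case: ifP => _.
    by apply: bigcupT_measurable => i; case: (hQ i).
  by apply: bigcapT_measurable => i; case: (hQ i).
- move=> j _ [c [Cc bc] <-]; case: ifP => jk.
    exists (c (l k)) => //; case: (hQ (c (l k))) => _ + _; apply.
    exists c => //; split=> //= n; rewrite jk ltnS leq_eqVlt.
    rewrite /b' jk /= => /orP[/eqP ->|nl].
      by rewrite (eqP jk) eqxx.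
    by case: eqP => [nlk|_]; [move: nl; rewrite nlk (eqP jk) ltnn|exact: bc].
  move=> i _; case: (hQ i) => _ + _; apply; exists c => //; split=> //=.
  by rewrite jk => n nl; rewrite -bb'//; exact: bc.
- apply/seteqP; split=> // x Qx.
  have := Qx k I; rewrite eqxx => -[i _ Qik].
  case: (hQ i) => _ _ /seteqP[+ _]; apply => j _.
  by have := Qx j I; case: eqP => [->//|_]; apply.
Qed.

(** From stage [n] to stage [n + 1] finitely many positions are lengthened, namely
the positions up to [n]; at stage [n] the segment in position [k] has length
[n - k], so all the positions are eventually served. *)
Let step b n : ~ separated (piece b (fun k => (n - k)%N)) ->
  exists2 b', (forall j, agree (n - j) (b j) (b' j)) &
    ~ separated (piece b' (fun k => (n.+1 - k)%N)).
Proof.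
move=> nsep.
have H N : exists2 b', (forall j, agree (n - j) (b j) (b' j)) &
    ~ separated (piece b' (fun k => if (k < N)%N then (n - k).+1 else (n - k)%N)).
  elim: N => [|N [b1 bb1 ns]].
    by exists b.
  have [b2 b12 ns2] := step_one N ns; exists b2.
    move=> j; apply: agree_trans (bb1 j) _.
    by apply: agree_le (b12 j); case: ifP.
  congr (~ separated (piece b2 _)) : ns2; apply/funext => k.
  by rewrite ltnS; case: (ltngtP k N) => [//|//|->].
have [b' bb' ns] := H n.+1; exists b' => //.
congr (~ separated (piece b' _)) : ns; apply/funext => k.
rewrite ltnS; case: leqP => [kn|nk]; first by rewrite subSn.
by have := ltnW nk; rewrite -!subn_eq0 => /eqP -> ; move: nk; rewrite -subn_eq0 => /eqP ->.
Qed.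

Lemma novikov_branch : ~ separated (fun k => h k @` C k) ->
  exists b, forall n, ~ separated (piece b (fun k => (n - k)%N)).
Proof.
move=> ns.
pose T := {bn : (nat -> baire) * nat |
  ~ separated (piece bn.1 (fun k => (bn.2 - k)%N))}.
have ns0 : ~ separated (piece (fun=> fun=> 0%N) (fun k => (0 - k)%N)).
  congr (~ separated _) : ns; apply/funext => k; rewrite /piece sub0n.
  by congr (_ @` _); apply/seteqP; split=> c //; case.
pose R (t t' : T) := (sval t').2 = (sval t).2.+1 /\
  forall j, agree ((sval t).2 - j) ((sval t).1 j) ((sval t').1 j).
have [t0R] : {f : nat -> T | f 0%N = exist _ (fun=> fun=> 0%N, 0%N) ns0 /\
    forall n, R (f n) (f n.+1)}.
  apply: dependent_choice => -[[b n] /= nsb].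
  have /cid2[b' bb' ns'] := step nsb.
  by exists (exist _ (b', n.+1) ns').
move=> [f0 fS].
have f2 n : (sval (t0R n)).2 = n.
  by elim: n => [|n IHn]; [rewrite f0|case: (fS n) => -> _; rewrite IHn].
pose B n := (sval (t0R n)).1.
have BS n m j : agree (n - j) (B n j) (B (n + m)%N j).
  elim: m => [|m IHm]; first by rewrite addn0.
  apply: agree_trans IHm _; rewrite addnS; case: (fS (n + m)%N) => _ /(_ j).
  by rewrite f2; apply: agree_le; rewrite leq_sub2r// leq_addr.
exists (fun k i => B (k + i).+1 k i) => n.
have := svalP (t0R n); rewrite f2 -/(B n) => nsn.
congr (~ separated _) : nsn; apply/funext => k; rewrite /piece.
congr (_ @` (_ `&` _)); apply/seteqP.
have hB : agree (n - k) (B n k) (fun i => B (k + i).+1 k i).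
  move=> i ink; have kin : ((k + i).+1 <= n)%N by rewrite -ltn_subRL.
  rewrite -(subnKC kin); symmetry; apply: BS.
  by rewrite subSn ?leq_addr// addKn.
by split=> c; apply: agree_trans => //; exact: agree_sym.
Qed.

End novikov.

(** If the sequence cannot be separated, [novikov_branch] gives one code in each
position such that no finite stage of the pieces around these codes can be
separated.  As the intersection of the [P k] is empty, the coded points are not
all equal, and a measurable set between two different ones separates the pieces
at a finite stage: a contradiction. *)
Theorem novikov_separation d (X : measurableType d) (P : nat -> set X) :
  countably_separated X -> (forall k, analytic (P k)) -> \bigcap_k P k = set0 ->
  exists Q : nat -> set X, [/\ forall k, measurable (Q k),
    forall k, P k `<=` Q k & \bigcap_k Q k = set0].
Proof.
move=> [G [mG sepG]] aP P0.
pose F := range G `|` range (fun n => ~` G n).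
have /choice[C /choice[h hC]] : forall k, coded (P k) F.
  move=> k; apply: aP; first by apply: countableU; exact: countable_image.
  by move=> _ [[n _ <-]|[n _ <-]]; [|apply: measurableC].
apply: contrapT.
have <- : (fun k => h k @` C k) = P by apply/funext => k; case: (hC k).
move=> /novikov_branch[b nsep].
(* a code outside a closed set stays outside it from a finite stage on *)
have away k A : F A \/ A = setT -> ~ (C k `&` h k @^-1` A) (b k) ->
    exists m, forall n, (m <= n)%N ->
      h k @` (C k `&` [set c | agree (n - k) (b k) c]) `<=` ~` A.
  move=> FA nA; have [m hm] : exists m, forall c, agree m (b k) c ->
      ~ (C k `&` h k @^-1` A) c.
    apply: bclosed_approx => //; case: (hC k) => cC _ hF.
    by case: FA => [/hF//|->]; rewrite preimage_setT setIT.
  (* at stage [m + k] the segment in position [k] has length [m] *)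
  exists (m + k)%N => n mkn _ [c [Cc bc] <-] Ac.
  apply: (hm c) => //; apply: agree_le bc.
  by rewrite -(addnK k m) leq_sub2r.
have Cb k : C k (b k).
  apply: contrapT => nCb; have [|m hm] := @away k setT (or_intror erefl).
    by case.
  apply: (nsep m); exists (fun j => if j == k then set0 else setT); split.
  - by move=> j; case: ifP.
  - by move=> j; case: eqP => [->|//]; rewrite -setCT; exact: hm.
  - by apply/seteqP; split=> // x /(_ k I); rewrite eqxx.
have [hb|/existsNP[k hk]] := pselect (forall k, h k (b k) = h 0%N (b 0%N)).
  have : (\bigcap_k P k) (h 0%N (b 0%N)).
    by move=> k _; case: (hC k) => _ <- _; exists (b k).
  by rewrite P0.
have k0 : k != 0%N by apply: contra_not_neq hk => ->.
have [i [Gk nG0]] := sepG _ _ hk.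
have [||m1 hm1] := @away k (~` G i).
- by left; right; exists i.
- by case=> _ /(_ Gk).
have [||m2 hm2] := @away 0%N (G i).
- by left; left; exists i.
- by case.
apply: (nsep (maxn m1 m2)).
exists (fun j => if j == k then G i else if j == 0%N then ~` G i else setT).
split.
- by move=> j; do 2 case: ifP => _ //; exact: measurableC.
- move=> j; case: eqP => [->|_].
    by rewrite -[G i]setCK; apply: hm1; exact: leq_maxl.
  by case: eqP => [->|//]; apply: hm2; exact: leq_maxr.
- apply/seteqP; split=> // x Qx; have := Qx k I; have := Qx 0%N I.
  by rewrite !eqxx eq_sym (negbTE k0).
Qed.

(** The case [A], [B], [B], ... of Novikov's theorem. *)
Theorem lusin_separation d (X : measurableType d) (A B : set X) :
  countably_separated X -> analytic A -> analytic B -> A `&` B = set0 ->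
  exists W, [/\ measurable W, A `<=` W & W `&` B = set0].
Proof.
move=> sX aA aB AB.
have [|||Q [mQ PQ Q0]] := @novikov_separation _ X
  (fun k => if k == 0%N then A else B).
- exact: sX.
- by move=> k; case: ifP.
- by rewrite -AB; apply/seteqP; split=> x => [hx|[Ax Bx] k _];
    [split; [exact: (hx 0%N) | exact: (hx 1%N)] | case: ifP].
exists (Q 0%N); split=> //; first exact: (PQ 0%N).
apply/seteqP; split=> // x [Q0x Bx]; rewrite -Q0 => -[|k] _ //.
exact: (PQ k.+1).
Qed.

(** * Borel sets with closed sections *)

Definition closed_sections (Z : Type) (T : topologicalType) (A : set (Z * T)) :=
  forall z, closed (xsection A z).

Lemma xsectionI (Z T : Type) (A B : set (Z * T)) z :
  xsection (A `&` B) z = xsection A z `&` xsection B z.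
Proof. by rewrite !xsectionE preimage_setI. Qed.

Lemma closed_sectionsI (Z : Type) (T : topologicalType) (A B : set (Z * T)) :
  closed_sections A -> closed_sections B -> closed_sections (A `&` B).
Proof. by move=> cA cB z; rewrite xsectionI; exact: closedI. Qed.

Lemma closed_sections_bigcap I (Z : Type) (T : topologicalType)
    (A : I -> set (Z * T)) :
  (forall i, closed_sections (A i)) -> closed_sections (\bigcap_i A i).
Proof.
move=> cA z; rewrite xsectionE preimage_bigcap.
by apply: closed_bigI => i _; rewrite -xsectionE; exact: cA.
Qed.

Lemma closed_sectionsX (Z : Type) (T : topologicalType) (W : set Z) (K : set T) :
  closed K -> closed_sections (W `*` K).
Proof.
move=> cK z; have [Wz|nWz] := boolP (z \in W); first by rewrite in_xsectionX.
by rewrite notin_xsectionX//; exact: closed0.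
Qed.

Lemma closed_sectionsCX (Z : Type) (T : topologicalType) (W : set Z)
    (U : set T) :
  open U -> closed_sections (~` (W `*` U)).
Proof.
move=> oU z; rewrite xsectionE -preimage_setC -xsectionE; apply: open_closedC.
have [Wz|nWz] := boolP (z \in W); first by rewrite in_xsectionX.
by rewrite notin_xsectionX//; exact: open0.
Qed.

Lemma second_countable_sequence (T : topologicalType) : @second_countable T ->
  exists V : nat -> set T, (forall n, open (V n)) /\
    forall x U, open U -> U x -> exists n, V n x /\ V n `<=` U.
Proof.
move=> [B cB [oB bB]]; have [e Be] := countable_sub_range set0 cB.
exists (fun n => if `[< B (e n) >] then e n else set0); split.
  by move=> n; case: asboolP => [/oB//|_]; exact: open0.
move=> x U oU Ux; have [|G [BG Gx] GU] := bB x U; first exact: open_nbhs_nbhs.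
have [n _ en] := Be _ BG; exists n.
by case: asboolP; rewrite en.
Qed.

Lemma compact_decreasing_bigcap (T : ptopologicalType) (F : nat -> set T) :
  compact [set: T] -> (forall n, closed (F n)) -> (forall n, F n !=set0) ->
  (forall n, F n.+1 `<=` F n) -> \bigcap_n F n !=set0.
Proof.
move=> cT cF F0 decF; apply: contrapT => /nonemptyPn F00.
have Fle m n : (m <= n)%N -> F n `<=` F m.
  elim: n => [|n IHn]; first by rewrite leqn0 => /eqP ->.
  rewrite leq_eqVlt => /orP[/eqP -> //|]; rewrite ltnS => /IHn.
  exact: subset_trans.
move: cT; rewrite compact_cover => /(_ nat setT (fun n => ~` F n)).
case=> [n _|x _|D _ DT]; first exact: closed_openC.
  apply: contrapT => nx; suff : (\bigcap_n F n) x by rewrite F00.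
  by move=> n _; apply: contrapT => nF; apply: nx; exists n.
have [x Fx] := F0 (\max_(i <- finmap.enum_fset D) i)%N.
have [i /= iD] := DT x I; apply.
by apply: Fle Fx; exact: leq_bigmax_seq.
Qed.

Lemma open_measurable_borel (T : ptopologicalType) (U : set T) :
  open U -> measurable (U : set (borel T)).
Proof. exact: sub_sigma_algebra. Qed.

Lemma closed_measurable_borel (T : ptopologicalType) (U : set T) :
  closed U -> measurable (U : set (borel T)).
Proof.
move=> cU; rewrite -[U]setCK; apply: measurableC; apply: open_measurable_borel.
exact: closed_openC.
Qed.

Section closed_sections.
Context d (Z : measurableType d) (T : ptopologicalType).
Hypotheses (sZ : souslin Z) (sT : souslin (borel T)).

(** For a point [(z, x)] outside [A] some basic neighbourhood of [x] misses [A_z].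
The set [P i.+1] of the [(z, x)] such that [V i] is not such a neighbourhood is
a projection, hence analytic, so Novikov's theorem divides the complement of
[A] into measurable parts, on the [i]-th of which the witness is [V i].  Lusin's
theorem then separates, in [Z], the projection of this part from the set of the
[z] such that [V i] meets [A_z]. *)
Lemma closed_sections_compl (V : nat -> set T) (A : set (Z * borel T)) :
  (forall n, open (V n)) ->
  (forall x U, open U -> U x -> exists n, V n x /\ V n `<=` U) ->
  measurable A -> closed_sections (A : set (Z * T)) ->
  exists W : nat -> set Z, (forall n, measurable (W n)) /\
    ~` A = \bigcup_n (W n `*` V n).
Proof.
move=> oV bV mA cA.
pose M i : set ((Z * borel T) * borel T) :=
  [set w | V i w.1.2 -> V i w.2 /\ A (w.1.1, w.2)].
have mM i : measurable (M i).
  rewrite (_ : M i = ~` ((snd \o fst) @^-1` (V i : set (borel T))) `|`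
     (snd @^-1` V i `&` (fun w => (w.1.1, w.2)) @^-1` A)); last first.
    apply/seteqP; rewrite /M; split=> w /=; last by case=> [nV /nV|[Vw Aw]].
    by move=> Mw; have [/Mw|] := pselect (V i w.1.2); [right|left].
  have mV : measurable (V i : set (borel T)) by exact: open_measurable_borel.
  apply: measurableU; [apply: measurableC|apply: measurableI].
  - apply: (measurable_preimageT _ mV).
    by apply: measurableT_comp; [exact: measurable_snd|exact: measurable_fst].
  - exact: (measurable_preimageT measurable_snd mV).
  - apply: (measurable_preimageT _ mA); apply: measurable_fun_pair.
      by apply: measurableT_comp; exact: measurable_fst.
    exact: measurable_snd.
have sZT : souslin (Z * borel T)%type by exact: souslin_prod.
pose P k := if k is i.+1 then fst @` M i else ~` A.
have [|k||Q [mQ PQ Q0]] := @novikov_separation _ _ P.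
- by case: sZT.
- case: k => [|i] /=; first by apply: measurable_analytic => //; exact: measurableC.
  apply: analytic_image; first exact: measurable_fst.
  by apply: measurable_analytic => //; exact: souslin_prod.
- apply/seteqP; split=> // -[z x] Px; have /= nA := Px 0%N I; apply: nA.
  suff : closure (xsection A z : set T) x.
    by rewrite -(proj1 (closure_id _) (cA z)) => /xsectionP.
  move=> U; rewrite nbhsE => -[G [oG Gx] GU].
  have [i [Vx VO]] := bV _ _ oG Gx.
  have [[[z' x'] y] /= My [zz' xx']] := Px i.+1 I.
  subst z' x'; have [Vy Ay] := My Vx; exists y; split; first exact/xsectionP.
  exact/GU/VO.
have aproj (B : set (Z * borel T)) : measurable B -> analytic (fst @` B).
  move=> mB; apply: analytic_image; first exact: measurable_fst.
  exact: measurable_analytic.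
have mTV i : measurable ([set: Z] `*` (V i : set (borel T))).
  by apply: measurableX => //; exact: open_measurable_borel.
have sep i : exists W, [/\ measurable W,
    fst @` ((~` A `\` Q i.+1) `&` (setT `*` V i)) `<=` W &
    W `&` fst @` (A `&` (setT `*` V i)) = set0].
  apply: lusin_separation.
  - by case: sZ.
  - apply: aproj; apply: measurableI => //; apply: measurableD => //.
    exact: measurableC.
  - by apply: aproj; exact: measurableI.
  - apply/seteqP; split=> // z [[[z' x] [[/= nA nQ] [_ Vx]] zz']].
    case=> -[z'' y] /= [Ay [_ Vy]] zz''; subst z' z''.
    apply: nQ; apply: (PQ i.+1); by exists ((z, x), y).
have [W hW] := choice sep.
exists W; split; first by move=> i; case: (hW i).
apply/seteqP; split=> [[z x] nA|[z x] [i _ [/= Wz Vx]] Azx].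
- have [i nQ] : exists i, ~ Q i.+1 (z, x).
    apply: contrapT => /forallNP nQ.
    suff : (\bigcap_k Q k) (z, x) by rewrite Q0.
    by move=> [_|i _]; [exact: (PQ 0%N) | apply: contrapT; exact: nQ].
  have [Vx|nVx] := pselect (V i x).
    exists i => //; split=> //=; case: (hW i) => _ + _; apply.
    by exists (z, x).
  by case: nQ; apply: (PQ i.+1); exists ((z, x), x).
- case: (hW i) => _ _ /seteqP[+ _] => /(_ z); apply; split=> //.
  by exists (z, x).
Qed.

Hypotheses (cptT : compact [set: T]) (cntT : @second_countable T).

(** [A_z] is empty exactly when the sets [V i] with [z] in [W i] cover [T]; by compactness
finitely many of them do, and there are countably many finite subcovers. *)
Theorem measurable_proj (A : set (Z * borel T)) :
  measurable A -> closed_sections (A : set (Z * T)) -> measurable (fst @` A).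
Proof.
move=> mA cA; have [V [oV bV]] := second_countable_sequence cntT.
have [W [mW AW]] := closed_sections_compl oV bV mA cA.
rewrite -[_ @` _]setCK; apply: measurableC.
pose E (s : seq nat) := if `[< [set: T] `<=` \bigcup_(i in [set` s]) V i >]
  then \bigcap_(i in [set` s]) W i else set0.
rewrite (_ : ~` _ = \bigcup_s E s); last first.
  apply/seteqP; split=> [z nz|z [s _]]; last first.
    rewrite /E; case: asboolP => // sT' Ez [[z' x] Ax /= zz']; subst z'.
    have [i si Vx] := sT' x I.
    suff : (~` A) (z, x) by [].
    by rewrite AW; exists i => //; split=> //; exact: Ez.
  move: cptT; rewrite compact_cover => /(_ nat [set i | W i z] V).
  case=> [i _|x _|D sD DT]; first exact: oV.
    have : (~` A) (z, x) by move=> Ax; apply: nz; exists (z, x).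
    by rewrite AW => -[i _ [Wz Vx]]; exists i.
  exists (finmap.enum_fset D) => //; rewrite /E; case: asboolP => // _ i /= iD.
  by have := sD _ iD; rewrite inE.
apply: countable_bigcupT_measurable => // s; rewrite /E; case: asboolP => // _.
exact: bigcap_measurableType.
Qed.

Hypothesis hsT : hausdorff_space T.

(** Shrink [A] through the closed sets [~` V n] in turn, keeping in each section
the points of [~` V n] whenever there are any.  By compactness something is
left in every section, and it is a single point because the complements of the
basic open sets separate points: a point left by the process forces the others
into every [~` V n] that contains it.  The graph obtained is measurable with
closed sections, so preimages of closed sets are projections of the kind
treated by [measurable_proj]. *)
Theorem measurable_selection (A : set (Z * borel T)) :
  measurable A -> closed_sections (A : set (Z * T)) ->
  (forall z, xsection A z !=set0) ->
  exists f : Z -> T, measurable_fun setT (f : Z -> borel T) /\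
    forall z, A (z, f z).
Proof.
move=> mA cA A0; have [V [oV bV]] := second_countable_sequence cntT.
have cVC n : closed (~` V n) by exact: open_closedC.
pose next n (B : set (Z * T)) := B `&` (setT `*` ~` V n `|`
  ~` (fst @` (B `&` (setT `*` ~` V n))) `*` setT).
pose fix B n : set (Z * T) := if n is m.+1 then next m (B m) else A.
have hB n : [/\ measurable (B n : set (Z * borel T)), closed_sections (B n) &
    forall z, xsection (B n) z !=set0].
  elim: n => [//|n [mB cB B0]].
  have mBV : measurable (fst @` (B n `&` (setT `*` ~` V n))).
    apply: (@measurable_proj (B n `&` (setT `*` ~` V n))).
      apply: measurableI => //; apply: measurableX => //.
      exact: closed_measurable_borel.
    by apply: closed_sectionsI => //; exact: closed_sectionsX.
  split=> /=.
  - apply: measurableI => //; apply: measurableU; apply: measurableX => //.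
      exact: closed_measurable_borel.
    exact: measurableC.
  - apply: closed_sectionsI => // z.
    rewrite xsectionE preimage_setU -!xsectionE.
    by apply: closedU; apply: closed_sectionsX => //; exact: closedT.
  - move=> z; have [[[z' x] [Bx Vx] /= zz']|nz] :=
      pselect ((fst @` (B n `&` (setT `*` ~` V n))) z).
      by exists x; apply/xsectionP; rewrite -zz'; split=> //; left.
    by have [x /xsectionP Bx] := B0 z; exists x; apply/xsectionP; split=> //; right.
pose B' := \bigcap_n B n.
have mB' : measurable (B' : set (Z * borel T)).
  by apply: bigcapT_measurable => n; case: (hB n).
have cB' : closed_sections B'.
  by apply: closed_sections_bigcap => n; case: (hB n).
have B'0 z : exists x, B' (z, x).
  have [|||x Bx] := @compact_decreasing_bigcap _ (fun n => xsection (B n) z) cptT.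
  - by move=> n; case: (hB n).
  - by move=> n; case: (hB n).
  - by move=> n x /xsectionP[Bx _]; apply/xsectionP.
  - by exists x => n _; exact/xsectionP/Bx.
have B'1 z x y : B' (z, x) -> B' (z, y) -> x = y.
  move=> Bx By; apply: contrapT => /eqP xy.
  move: hsT; rewrite open_hausdorff => /(_ _ _ xy)[[U G] /= [xU yG] [oU oG UG]].
  have [n [Vy VG]] := bV _ _ oG (set_mem yG).
  have nVx : ~ V n x.
    move=> /VG Gx; suff : (U `&` G) x by rewrite (eqP UG).
    by split=> //; exact: set_mem.
  have [_ [[_ //]|[+ _]]] := By n.+1 I; apply; exists (z, x) => //; split=> //.
  exact: Bx.
have [f Bf] := choice B'0; exists f; split; last by move=> z; exact: (Bf z 0%N I).
apply: (@measurability _ _ Z (borel T) setT f (@open T)) => //.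
move=> _ [U oU <-]; rewrite setTI -[_ @^-1` _]setCK; apply: measurableC.
rewrite (_ : ~` _ = fst @` (B' `&` (setT `*` ~` U))).
  apply: measurable_proj.
    apply: measurableI => //; apply: measurableX => //.
    by apply: closed_measurable_borel; exact: open_closedC.
  apply: closed_sectionsI => //; apply: closed_sectionsX; exact: open_closedC.
apply/seteqP; split=> [z nU|_ [[z x] [Bx [_ nU]] <-] /= Ufz].
  by exists (z, f z).
by apply: nU; rewrite /= (B'1 _ _ _ Bx (Bf z)).
Qed.

End closed_sections.

(** * Polish spaces are Souslin *)

Section polish.
Context (R : realType) (T : pseudoPMetricType R).
Hypothesis hsT : hausdorff_space T.

Let r (n : nat) : R := n.+1%:R^-1.

Let r_small (e : R) (k : nat) : 0 < e -> exists n, r n *+ k < e.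
Proof.
move=> e0; have [|n] := @ltr_add_invr R 0 (e / k.+1%:R); first exact: divr_gt0.
rewrite add0r => ne; exists n; apply: (@le_lt_trans _ _ (r n *+ k.+1)).
  by rewrite mulrS lerDr invr_ge0.
by rewrite -mulr_natr -ltr_pdivlMr.
Qed.

Lemma balls_eq (x y : T) : (forall e, 0 < e -> ball x e y) -> x = y.
Proof.
move=> xy; apply: hsT => A B /nbhs_ballP[e /= e0 eA] By.
by exists y; split; [exact/eA/xy | exact: nbhs_singleton].
Qed.

Lemma separating_closed : separating (@closed T).
Proof.
move=> x y /eqP xy; move: hsT; rewrite open_hausdorff.
move=> /(_ _ _ xy)[[U V] /= [/set_mem xU /set_mem yV] [oU oV /eqP UV]].
exists (~` U), (~` V); split => //; [exact: open_closedC| exact: open_closedC|].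
by rewrite -setCI UV setC0.
Qed.

Hypothesis cauchyT : forall F : set_system T, ProperFilter F -> cauchy F -> cvg F.
Variable q : nat -> T.
Hypothesis q_dense : forall (x : T) (e : R), 0 < e -> exists n, ball (q n) e x.

(** Codes are sequences of indices of points of the dense sequence, the [n]-th one at
distance less than [1 / (n + 1)] from a common point.  Asking for this point
only up to each finite stage makes the set of codes closed by definition. *)
Let C : set baire := [set b | forall n, exists x,
  forall i, (i < n)%N -> ball (q (b i)) (r i) x].

Let h (b : baire) : T := lim (q \o b @ \oo).

Let C_ball2 b m n : C b -> (n <= m)%N -> ball (q (b n)) (r n *+ 2) (q (b m)).
Proof.
move=> /(_ m.+1)[x hx] nm; rewrite mulr2n; apply: (@ball_triangle _ _ x).
  exact: hx.
apply: ball_sym; apply: le_ball (hx m (ltnSn m)).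
by rewrite lef_pV2 ?posrE// ler_nat.
Qed.

Let C_ball b n : C b -> ball (q (b n)) (r n *+ 3) (h b).
Proof.
move=> Cb; have : cvg (q \o b @ \oo).
  apply: cauchyT; apply: cauchy_exP => e e0.
  have [m rm] := r_small 2 e0; exists (q (b m)).
  exists m => // k /= mk; apply: le_ball (C_ball2 Cb mk); exact: ltW.
move=> /cvg_ballP /(_ (r n)) [|m _ hm]; first by rewrite invr_gt0.
rewrite mulrSr; apply: (@ball_triangle _ _ (q (b (maxn m n)))).
  by apply: C_ball2 => //; exact: leq_maxr.
by apply: ball_sym; apply: hm; exact: leq_maxl.
Qed.

Lemma coded_closed : coded setT (@closed T).
Proof.
have cC : bclosed C.
  move=> b hb n; have [c Cc bc] := hb n; have [x hx] := Cc n.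
  by exists x => i ni; rewrite bc//; exact: hx.
exists C, h; split=> //.
- apply/seteqP; split=> // x _.
  have /choice[b hb] : forall i, exists n, ball (q n) (r i) x.
    by move=> i; apply: q_dense; rewrite invr_gt0.
  have Cb : C b by move=> n; exists x => i _; exact: hb.
  exists b => //; symmetry; apply: balls_eq => e e0.
  have [n rn] := r_small 4 e0; apply: (le_ball (ltW rn)).
  rewrite mulrS; apply: (@ball_triangle _ _ (q (b n))); first exact: ball_sym.
  exact: C_ball.
- move=> F cF b hb.
  have Cb : C b by apply: cC => n; have [c [Cc _] bc] := hb n; exists c.
  split=> //; apply: cF => U /nbhs_ballP[e /= e0 eU].
  have [n rn] := r_small 6 e0; have [c [Cc Fc] bc] := hb n.+1.
  exists (h c); split=> //; apply: eU; apply: (le_ball (ltW rn)).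
  rewrite (mulrnDr _ 3 3); apply: (@ball_triangle _ _ (q (b n))).
    by apply: ball_sym; exact: C_ball.
  by rewrite bc//; exact: C_ball.
Qed.

(** An open set is the union of the closed sets [A n]: a point of
[A n] is within [r n] of a point whose ball of radius [r n] lies in [U]. *)
Lemma coded_open (U : set T) : open U ->
  coded setT (@closed T `|` [set U; ~` U]).
Proof.
move=> oU; pose A n := closure [set x | ball x (r n) `<=` U].
have AU : \bigcup_n A n = ~` ~` U.
  rewrite setCK; apply/seteqP; split=> [x [n _ Ax]|x Ux].
    have [|y [yU xy]] := Ax (ball x (r n)).
      by apply: nbhsx_ballx; rewrite invr_gt0.
    exact/yU/ball_sym.
  have /nbhs_ballP[e /= e0 eU] : nbhs x U by exact: open_nbhs_nbhs.
  have [n rn] := r_small 1 e0; exists n => //; apply: subset_closure.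
  by apply: subset_trans eU; exact/le_ball/ltW.
have cU : closed (~` U) by exact: open_closedC.
have := coded_witness coded_closed (fun n => @closed_closure _ _) cU AU.
rewrite setCK => cw; apply: sub_coded cw => B [?|[->|->]].
- by left.
- by right.
- by left.
Qed.

Theorem souslin_borel : souslin (borel T).
Proof.
have sT : countably_separated (borel T).
  exists (fun n => if unpickle n is Some (i, j) then (ball (q i) (r j))° else set0).
  split=> [n|x y xy].
    case: unpickle => [[i j]|]; last exact: measurable0.
    by apply: sub_sigma_algebra; exact: open_interior.
  have [e [e0 nxy]] : exists e, 0 < e /\ ~ ball (x : T) e (y : T).
    apply: contrapT => /forallNP nxy; apply: xy; apply: balls_eq => e e0.
    by apply: contrapT => nb; apply: (nxy e).
  have [j rj] := r_small 2 e0.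
  have [i /= qi] : exists i, (ball (q i) (r j))° x.
    have rj2 : 0 < r j / 2 by rewrite divr_gt0// invr_gt0.
    have [i hi] := q_dense x rj2; exists i.
    apply/nbhs_ballP; exists (r j / 2) => //.
    by move=> z xz; rewrite [r j]splitr; exact: ball_triangle xz.
  exists (pickle (i, j)); rewrite pickleK; split=> // /interior_subset qy.
  apply: nxy; apply: (le_ball (ltW rj)); rewrite mulr2n.
  apply: ball_triangle qy; apply: ball_sym; exact: interior_subset.
apply: (@souslin_generated _ (borel T) (@closed T)) => //.
- exact: coded_closed.
- exact: separating_closed.
- apply: smallest_sub.
    exact: (coded_sigma_algebra coded_closed separating_closed).
  by move=> U oU; exact: coded_open.
Qed.

End polish.

Lemma dense_sequence (R : realType) (T : pseudoPMetricType R) (D : set T) :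
  countable D -> dense D -> exists q : nat -> T,
  forall (x : T) (e : R), 0 < e -> exists n, ball (q n) e x.
Proof.
move=> cD dD; have [q Dq] := countable_sub_range point cD; exists q => x e e0.
have [||y [/interior_subset xy /Dq[n _ qn]]] := dD (ball x e)°.
- by exists x; exact: nbhsx_ballx.
- exact: open_interior.
- by exists n; rewrite qn; exact: ball_sym.
Qed.

Lemma standard_borel_souslin (R : realType) d (Z : measurableType d) :
  standard_borel R Z -> souslin Z.
Proof.
move=> [P [phi [psi [[D cD dD] phiK psiK mphi mpsi]]]].
have [q hq] := dense_sequence cD dD.
apply: (souslin_isomorphic mphi mpsi phiK).
apply: (souslin_borel _ _ hq) => [|F PF]; first exact: metric_hausdorff.
exact: cauchy_cvg.
Qed.

Lemma compact_souslin_borel (R : realType) (T : pseudoPMetricType R) :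
  hausdorff_space T -> compact [set: T] -> souslin (borel T).
Proof.
move=> hsT cT; have [V [oV bV]] :=
  second_countable_sequence (compact_second_countable cT).
pose q n := xget point (V n).
apply: (@souslin_borel _ _ hsT _ q) => [F PF cF|x e e0].
  by apply: compact_cauchy_cvg cT => //; exact: filterT.
have [||n [Vx Vball]] := bV x (ball x e)°; first exact: open_interior.
- exact: nbhsx_ballx.
- exists n; apply: ball_sym; apply: interior_subset; apply: Vball.
  exact: (xgetI point Vx).
Qed.

(** * Covers by sets without separated points *)

Section fragmentation.
Context d (Z : measurableType d) (T : ptopologicalType).
Hypotheses (sZ : souslin Z) (sT : souslin (borel T)).
Hypotheses (cptT : compact [set: T]) (cntT : @second_countable T).
Variables K V : nat -> bool -> set T.
Hypothesis closedK : forall p b, closed (K p b).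
Hypothesis openV : forall p b, open (V p b).
Hypothesis subVK : forall p b, V p b `<=` K p b.
Variable A : set (Z * borel T).
Hypotheses (mA : measurable A) (cA : closed_sections (A : set (Z * T))).

Local Notation label := (seq (nat * bool)).

(** In [K p b] and [V p b], [p] numbers a gap and [b] one of its two sides. *)
Fixpoint cell (a : label) : set T :=
  if a is c :: a' then K c.1 c.2 `&` cell a' else setT.

Lemma closed_cell a : closed (cell a).
Proof. by elim: a => [|c a IHa] /=; [exact: closedT | exact: closedI]. Qed.

Definition small (C : set (Z * borel T)) :=
  [/\ measurable C, closed_sections (C : set (Z * T)), C `<=` A &
      forall z x y p b, C (z, x) -> C (z, y) -> V p b x -> ~ V p (~~ b) y].

Definition coverable (E : set (Z * borel T)) :=
  exists C : nat -> set (Z * borel T),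
    (forall n, small (C n)) /\ E `<=` \bigcup_n C n.

Let small0 : small set0.
Proof. by split=> // z; rewrite xsection0; exact: closed0. Qed.

Let sub_coverable E E' : E `<=` E' -> coverable E' -> coverable E.
Proof. by move=> EE' [C [sC E'C]]; exists C; split=> //; exact: subset_trans E'C. Qed.

Let coverable_bigcup (E : nat -> set (Z * borel T)) :
  (forall n, coverable (E n)) -> coverable (\bigcup_n E n).
Proof.
move=> /choice[C hC].
exists (fun k => if unpickle k is Some (n, m) then C n m else set0); split.
  by move=> k; case: unpickle => // -[n m]; case: (hC n).
move=> w [n _ Enw]; have [_ /(_ _ Enw)[m _ Cw]] := hC n.
by exists (pickle (n, m)) => //; rewrite pickleK.
Qed.

Let coverableU E E' : coverable E -> coverable E' -> coverable (E `|` E').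
Proof.
move=> cE cE'; rewrite -bigcup2E; apply: coverable_bigcup => -[|[|n]] //=.
by exists (fun=> set0); split=> // w.
Qed.

Let small_coverable C : small C -> coverable C.
Proof. by move=> sC; exists (fun=> C); split=> // w Cw; exists 0%N. Qed.

Let coverable0 : coverable set0. Proof. exact: small_coverable. Qed.

(** Measurable sets of parameters over which the part of [A] in the cell needs no
further splitting. *)
Definition handled (a : label) (U : set Z) :=
  measurable U /\ coverable (A `&` (U `*` cell a)).

Let handled_bigcup a (U : nat -> set Z) :
  (forall n, handled a (U n)) -> handled a (\bigcup_n U n).
Proof.
move=> hU; split; first by apply: bigcupT_measurable => n; case: (hU n).
apply: sub_coverable (coverable_bigcup (fun n => (hU n).2)).
by move=> [z x] [Azx [[n _ Unz] Kx]]; exists n.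
Qed.

Let handled0 a : handled a set0.
Proof.
by split=> //; apply: sub_coverable coverable0 => -[z x] [_ []].
Qed.

Definition good (l : seq label) (W : set Z) :=
  exists U : label -> set Z, (forall a, handled a (U a)) /\
    W `<=` \bigcup_(a in [set` l]) U a.

Let good_bigcup l (W : nat -> set Z) :
  (forall n, good l (W n)) -> good l (\bigcup_n W n).
Proof.
move=> /choice[U hU]; exists (fun a => \bigcup_n U n a); split.
  by move=> a; apply: handled_bigcup => n; case: (hU n).
move=> z [n _ Wz]; have [_ /(_ _ Wz)[a la Uz]] := hU n.
by exists a => //; exists n.
Qed.

Let sub_good l W W' : W `<=` W' -> good l W' -> good l W.
Proof. by move=> WW' [U [hU lU]]; exists U; split=> //; exact: subset_trans lU. Qed.

Definition meets (a : label) : set Z := fst @` (A `&` (setT `*` cell a)).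

Let measurable_meets a : measurable (meets a).
Proof.
apply: measurable_proj => //.
  apply: measurableI => //; apply: measurableX => //.
  by apply: closed_measurable_borel; exact: closed_cell.
by apply: closed_sectionsI => //; apply: closed_sectionsX; exact: closed_cell.
Qed.

(** Over parameters [z] for which a cell misses [A_z] there is nothing to cover. *)
Let good_avoid l a : a \in l -> good l (~` meets a).
Proof.
move=> la; exists (fun c => if c == a then ~` meets a else set0); split.
  move=> c; case: eqP => [->|_]; last exact: handled0.
  split; first exact: measurableC.
  apply: sub_coverable coverable0 => -[z x] [Azx [/= nm ax]]; apply: nm.
  by exists (z, x).
by move=> z nm; exists a => //; rewrite eqxx.
Qed.

(** Over [E], each gap has a side on which the corresponding child of the cell [a]
is already covered.  Remove from [A], over [E] and in the cell [a], what is
covered on the open sides.  The remainder [C] has closed sections, and two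
points of a section of [C] on opposite open sides of a gap would show that
neither child is covered there. *)
Let good_split l a W :
  (forall p, good (l ++ [:: (p, false) :: a; (p, true) :: a]) W) ->
  good (a :: l) W.
Proof.
move=> /choice[U hU]; pose U' c := \bigcup_p U p c.
have hU' c : handled c (U' c).
  by apply: handled_bigcup => p; case: (hU p).
have mU' c : measurable (U' c) by case: (hU' c).
pose E := \bigcap_p (U' ((p, false) :: a) `|` U' ((p, true) :: a)).
have mE : measurable E.
  by apply: bigcapT_measurable => p; exact: measurableU.
pose N p b := U' ((p, b) :: a) `*` (V p b : set (borel T)).
pose C := A `&` (E `*` cell a) `&` \bigcap_p ~` (N p false `|` N p true).
have handledE : handled a E.
  split=> //.
  have covN b : coverable
      (\bigcup_p (A `&` (U' ((p, b) :: a) `*` cell ((p, b) :: a)))).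
    by apply: coverable_bigcup => p; case: (hU' ((p, b) :: a)).
  apply: sub_coverable (coverableU (small_coverable (_ : small C))
    (coverableU (covN false) (covN true))).
    move=> [z x] [Azx [Ez ax]].
    have [NN|] := pselect ((\bigcap_p ~` (N p false `|` N p true)) (z, x)).
      by left.
    rewrite -setC_bigcup => /contrapT[p _ [[/= Uz Vx]|[/= Uz Vx]]]; right.
      by left; exists p => //; split=> //; split=> //; split=> //; exact: subVK.
    by right; exists p => //; split=> //; split=> //; split=> //; exact: subVK.
  split.
  - apply: measurableI.
      apply: measurableI => //; apply: measurableX => //.
      by apply: closed_measurable_borel; exact: closed_cell.
    apply: bigcapT_measurable => p; apply: measurableC.
    by apply: measurableU; apply: measurableX => //; exact: open_measurable_borel.
  - apply: closed_sectionsI.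
      apply: closed_sectionsI => //; apply: closed_sectionsX.
      exact: closed_cell.
    apply: closed_sections_bigcap => p.
    rewrite setCU; apply: closed_sectionsI; exact: closed_sectionsCX.
  - by move=> w [[]].
  - move=> z x y p b [[_ [Ez _]] Cx] [_ Cy] Vx Vy.
    have nU c t : (\bigcap_p ~` (N p false `|` N p true)) (z, t) -> V p c t ->
        ~ U' ((p, c) :: a) z.
      by move=> /(_ p I) /not_orP[nf nt] Vt Uz; case: c Vt Uz => Vt Uz;
        [apply: nt|apply: nf].
    have nx := nU _ _ Cx Vx; have ny := nU _ _ Cy Vy.
    by case: (Ez p I); case: b nx ny {Vx Vy}.
exists (fun c => if c == a then E `|` U' c else U' c); split.
  move=> c; case: eqP => [->|//]; rewrite -bigcup2E.
  by apply: handled_bigcup => -[|[|n]] /=.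
move=> z Wz; have [Ez|] := pselect (E z).
  by exists a; rewrite /= ?mem_head// eqxx; left.
rewrite /E -[X in ~ X -> _]/((\bigcap_p _) z) => /existsNP[p /not_implyP[_ nUz]].
have [_ /(_ _ Wz)[c]] := hU p; rewrite /= mem_cat !inE => lc Uz.
have U'z : U' c z by exists p.
case/orP: lc => [lc|/orP[/eqP cE|/eqP cE]].
- exists c; first by rewrite /= inE lc orbT.
  by case: ifP => // _; right.
- by exfalso; apply: nUz; left; rewrite -cE.
- by exfalso; apply: nUz; right; rewrite -cE.
Qed.

Let goodU l W W' : good l W -> good l W' -> good l (W `|` W').
Proof.
move=> gW gW'; rewrite -bigcup2E; apply: good_bigcup => -[|[|n]] //=.
by exists (fun=> set0); split=> // w.
Qed.

(** An infinite binary tree of cells, with nodes numbered as in a heap: the children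
of node [n] are the nodes [2 n + 1] and [2 n + 2]. *)
Definition scheme (z : Z) (u : nat -> label) :=
  forall n, meets (u n) z /\
    exists p, u n.*2.+1 = (p, false) :: u n /\ u n.*2.+2 = (p, true) :: u n.

(** One step of the construction of a tree: the first cell of the queue [l] is
required to be met, then split by a gap, its children joining the end of the
queue, and finally one more digit of the code of [z] is fixed.  Each of the
three operations covers [W] by countably many sets or splittings, one of which
has to be bad again. *)
Let fusion_step l b n W C (h : baire -> Z) :
  size l = n.+1 -> W `<=` h @` (C `&` [set c | agree n b c]) -> ~ good l W ->
  exists p b' W',
    [/\ agree n b b',
      ~ good (behead l ++ [:: (p, false) :: head [::] l; (p, true) :: head [::] l]) W',
      W' `<=` h @` (C `&` [set c | agree n.+1 b' c]) & W' `<=` W `&` meets (head [::] l)].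
Proof.
case: l => // a l _ Wh ngood /=; set D := meets a.
have ng1 : ~ good (a :: l) (W `&` D).
  apply: contra_not ngood => gWD.
  apply: sub_good (goodU gWD (good_avoid (mem_head a l))) => z Wz.
  by have [Dz|nDz] := pselect (D z); [left|right].
have [p ng2] : exists p,
    ~ good (l ++ [:: (p, false) :: a; (p, true) :: a]) (W `&` D).
  by apply: contrapT => /forallNP H; apply: ng1; apply: good_split => p; apply: contrapT; exact: H.
pose b' i j := if j == n then i else b j.
have [i ng3] : exists i, ~ good (l ++ [:: (p, false) :: a; (p, true) :: a])
    (W `&` D `&` h @` (C `&` [set c | agree n.+1 (b' i) c])).
  apply: contrapT => /forallNP H; apply: ng2.
  apply: (@sub_good _ _ (\bigcup_i (W `&` D `&`
    h @` (C `&` [set c | agree n.+1 (b' i) c])))); last first.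
    by apply: good_bigcup => i; apply: contrapT; exact: H.
  move=> z [Wz Dz]; have [c [Cc bc] hc] := Wh z Wz.
  exists (c n) => //; split=> //; exists c => //; split=> //= j.
  by rewrite /b' ltnS leq_eqVlt; case: eqP => [->|_ /bc].
exists p, (b' i), (W `&` D `&` h @` (C `&` [set c | agree n.+1 (b' i) c])).
by split=> // j jn; rewrite /b' ltn_eqF.
Qed.

(** The cell handled at step [n] is the [n]-th one that entered the queue, hence the
heap numbering.  The sets [W n] shrink to the point [z] coded by the limit [b];
as the sets [meets a] are closed in the coding, [z] belongs to all those imposed
along the way. *)
Let exists_scheme : ~ good [:: [::]] setT -> exists z u, scheme z u.
Proof.
move=> ng.
have [C [h [cC hT hD]]] : coded [set: Z] (range meets).
  case: sZ => _ aZ; apply: aZ; first exact: countable_image.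
  by move=> _ [a _ <-].
pose inv (l : seq label) b n W := [/\ size l = n.+1,
  W `<=` h @` (C `&` [set c | agree n b c]) & ~ good l W].
pose St := {s : seq label * baire * nat * set Z | inv s.1.1.1 s.1.1.2 s.1.2 s.2}.
pose R (s t : St) := let: (l, b, n, W) := sval s in
  let: (l', b', n', W') := sval t in
  [/\ n' = n.+1, agree n b b', W' `<=` W `&` meets (head [::] l) &
    exists p, l' = behead l ++ [:: (p, false) :: head [::] l; (p, true) :: head [::] l]].
have inv0 : inv [:: [::]] (fun=> 0%N) 0%N setT.
  split=> // z _; have : (h @` C) z by rewrite hT.
  by case=> c Cc <-; exists c.
have [f [f0 fS]] : {f : nat -> St |
    f 0%N = exist _ ([:: [::]], fun=> 0%N, 0%N, setT) inv0 /\ forall n, R (f n) (f n.+1)}.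
  apply: dependent_choice => -[[[[l b] n] W] /= [sl Wh ngW]].
  have /cid[p /cid[b' /cid[W' [bb' ngW' Wh' W'W]]]] := fusion_step sl Wh ngW.
  have inv' : inv (behead l ++ [:: (p, false) :: head [::] l; (p, true) :: head [::] l])
      b' n.+1 W'.
    by split=> //; rewrite size_cat size_behead sl /= addn2.
  exists (exist _ (_, b', n.+1, W') inv'); rewrite /R /=; split=> //.
  by exists p.
pose L n := (sval (f n)).1.1.1; pose B n := (sval (f n)).1.1.2.
pose W n := (sval (f n)).2.
have fn n : (sval (f n)).1.2 = n.
  elim: n => [|n IHn]; first by rewrite f0.
  move: (fS n) IHn; rewrite /R.
  by case: (sval (f n)) => [[[? ?] ?] ?]; case: (sval (f n.+1)) => [[[? ?] ?] ?] /= [-> _ _ _] ->.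
have invf n : inv (L n) (B n) n (W n) by have := svalP (f n); rewrite fn.
have stepf n : [/\ agree n (B n) (B n.+1), W n.+1 `<=` W n `&` meets (head [::] (L n)) &
    exists p, L n.+1 = behead (L n) ++
      [:: (p, false) :: head [::] (L n); (p, true) :: head [::] (L n)]].
  move: (fS n) (fn n); rewrite /R /L /B /W.
  by case: (sval (f n)) => [[[? ?] ?] ?]; case: (sval (f n.+1)) => [[[? ?] ?] ?] /= [_ ? ? ?] <-.
pose u n := head [::] (L n).
(* the queue at step [n] consists of the nodes [n, ..., 2 n] *)
have Lu i n : (i <= n)%N -> nth [::] (L n) i = u (n + i)%N.
  elim: i n => [|i IHi] n ni; first by rewrite nth0 addn0.
  rewrite addnS -addSn -IHi; last by rewrite ltnW// ltnW.
  have [_ _ [p ->]] := stepf n; rewrite nth_cat size_behead.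
  by case: (invf n) => -> _ _; rewrite /= ni nth_behead.
have WS m n : W (n + m)%N `<=` W n.
  elim: m => [|m IHm]; first by rewrite addn0.
  apply: subset_trans IHm; rewrite addnS.
  by have [_ + _] := stepf (n + m)%N => /subset_trans; apply; exact: subIsetl.
have BS n m : agree n (B n) (B (n + m)%N).
  elim: m => [|m IHm]; first by rewrite addn0.
  apply: agree_trans IHm _; rewrite addnS; have [bb _ _] := stepf (n + m)%N.
  by apply: agree_le bb; exact: leq_addr.
pose b i := B i.+1 i.
have Bb n : agree n (B n) b.
  by move=> i ni; rewrite -(subnKC ni); symmetry; apply: BS.
exists (h b), u => n; split.
  suff : (C `&` h @^-1` meets (u n)) b by case.
  apply: hD; first by exists (u n).
  move=> m; have [z Wz] : W (n.+1 + m)%N !=set0.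
    apply: contrapT => /nonemptyPn W0; case: (invf (n.+1 + m)%N) => _ _; apply.
    by rewrite W0; exists (fun=> set0); split=> // z.
  have [_ /(_ z Wz)[c [Cc Bc] hc] _] := invf (n.+1 + m)%N.
  exists c.
    split=> //; rewrite /= hc.
    by have [_ /(_ z (WS _ _ _ Wz))[]] := stepf n.
  apply: agree_trans (_ : agree m b (B (n.+1 + m)%N)) _.
    by apply: agree_sym; apply: agree_le (Bb _); exact: leq_addl.
  by apply: agree_le Bc; exact: leq_addl.
have [_ _ [p LE]] := stepf n; exists p.
have -> : n.*2.+1 = (n.+1 + n)%N by rewrite addSn addnn.
rewrite -addnS -!Lu//.
rewrite LE !nth_cat size_behead; case: (invf n) => -> _ _ /=.
by rewrite ltnn subnn ltnNge leqnSn /= subSn// subnn.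
Qed.

Theorem countable_small_cover :
  (forall z u, ~ scheme z u) -> coverable A.
Proof.
move=> nsch; have [[U [hU TU]]|/exists_scheme[z [u /nsch//]]] :=
  pselect (good [:: [::]] setT).
case: (hU [::]) => _; apply: sub_coverable => -[z x] Azx; split=> //.
split=> //=; have [a] := TU z I.
by rewrite /= inE => /eqP ->.
Qed.

End fragmentation.

(** * The cube *)

Section cube.
Context {R : realType}.
Implicit Types (x y : cube R) (n : nat).

Let coord n x : R := set_val (x n).

Lemma continuous_coord n : continuous (coord n).
Proof.
move=> x; apply: (@continuous_comp (cube R) (`[-1 : R, 1]%classic : Type) R
  (fun x : cube R => x n) set_val).
  exact (@proj_continuous nat (fun=> (`[-1 : R, 1]%classic : Type)) n x).
exact: (@initial_continuous (`[-1 : R, 1]%classic : Type) R set_val).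
Qed.

Lemma coord_inj x y : (forall n, coord n x = coord n y) -> x = y.
Proof. by move=> xy; apply/funext => n; apply: val_inj; exact: xy. Qed.

Lemma hausdorff_cube : hausdorff_space (cube R).
Proof.
rewrite open_hausdorff => x y xy.
have [n /eqP nxy] : exists n, coord n x <> coord n y.
  by apply/existsNP => xy'; move/eqP: xy; apply; exact: coord_inj.
move: (@norm_hausdorff _ R); rewrite open_hausdorff.
move=> /(_ _ _ nxy)[[U V] /= [/set_mem xU /set_mem yV] [oU oV /eqP UV]].
exists (coord n @^-1` U, coord n @^-1` V) => /=.
  by split; exact: mem_set.
split; last by rewrite -preimage_setI UV preimage_set0.
- by apply: open_comp => // z _; exact: continuous_coord.
- by apply: open_comp => // z _; exact: continuous_coord.
Qed.

Lemma compact_itv_type : compact [set: (`[-1 : R, 1]%classic : Type)].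
Proof.
move=> F PF _.
have F1 : (set_val @ F) (`[-1, 1]%classic : set R).
  by apply: (@filterS _ F _ setT) => [z _|]; [exact: set_valP | exact: filterT].
have [r [r1 clr]] := @segment_compact R (-1) 1 _ _ F1.
exists (exist _ r (mem_set r1)); split=> //.
move=> A B FA; rewrite nbhsE => -[G [[V oV <-] Gr] GB].
have [||_ [[z Az <-] Vz]] := clr (set_val @` A) V.
- by rewrite /fmap /=; apply: filterS FA => z Az; exists z.
- exact: open_nbhs_nbhs.
- by exists z; split=> //; exact: GB.
Qed.

Lemma compact_cube : compact [set: cube R].
Proof.
rewrite (_ : setT = [set x : cube R | forall i, setT (x i)]).
  have cT := @tychonoff nat (fun=> (`[-1 : R, 1]%classic : Type)) (fun=> setT)
    (fun=> compact_itv_type).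
  exact cT.
by apply/seteqP; split.
Qed.

Lemma coord_dist_le2 x y n : `|coord n x - coord n y| <= 2.
Proof.
have bnd z : -1 <= coord n z <= 1 by have := set_valP (z n); rewrite /= in_itv.
move: (coord n x) (coord n y) (bnd x) (bnd y) => a b /andP[a1 a2] /andP[b1 b2].
by rewrite ler_norml; apply/andP; split; lra.
Qed.

Lemma coord_dist_supdist x y n : `|coord n x - coord n y| <= supdist x y.
Proof.
apply: ub_le_sup; last by exists n.
by exists 2 => _ [m _ <-]; exact: coord_dist_le2.
Qed.

Lemma supdist_le x y e :
  (forall n, `|coord n x - coord n y| <= e) -> supdist x y <= e.
Proof.
move=> xye; apply: ge_sup; first by exists `|coord 0 x - coord 0 y|, 0%N.
by move=> _ [n _ <-]; exact: xye.
Qed.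

(** A gap [(n, p, q)], numbered by [pickle], has the sides [x_n <= p] and
[q <= x_n].  Numbers of narrow gaps, or of none, get empty sides. *)
Section gap.
Variable e : R.

Definition wide_gap (p q : rat) := ratr p + e <= ratr q.

Definition closed_side (k : nat) (b : bool) : set (cube R) :=
  if unpickle k is Some (n, p, q) then
    if `[< wide_gap p q >] then
      if b then [set x | ratr q <= coord n x] else [set x | coord n x <= ratr p]
    else set0
  else set0.

Definition open_side (k : nat) (b : bool) : set (cube R) :=
  if unpickle k is Some (n, p, q) then
    if `[< wide_gap p q >] then
      if b then [set x | ratr q < coord n x] else [set x | coord n x < ratr p]
    else set0
  else set0.

Lemma closed_closed_side k b : closed (closed_side k b).
Proof.
rewrite /closed_side; case: unpickle => [[[n p] q]|]; last exact: closed0.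
case: ifP => _; last exact: closed0.
case: b.
- apply: (@closed_comp _ _ (coord n) [set t | ratr q <= t]); last exact: closed_ge.
  by move=> x _; exact: continuous_coord.
- apply: (@closed_comp _ _ (coord n) [set t | t <= ratr p]); last exact: closed_le.
  by move=> x _; exact: continuous_coord.
Qed.

Lemma open_open_side k b : open (open_side k b).
Proof.
rewrite /open_side; case: unpickle => [[[n p] q]|]; last exact: open0.
case: ifP => _; last exact: open0.
case: b.
- apply: (@open_comp _ _ (coord n) [set t | ratr q < t]); last exact: open_gt.
  by move=> x _; exact: continuous_coord.
- apply: (@open_comp _ _ (coord n) [set t | t < ratr p]); last exact: open_lt.
  by move=> x _; exact: continuous_coord.
Qed.

Lemma open_closed_side k b : open_side k b `<=` closed_side k b.
Proof.
rewrite /open_side /closed_side; case: unpickle => [[[n p] q]|] //.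
by case: ifP => _; case: b => x //= /ltW.
Qed.

Lemma far_sides x y : ~ supdist x y <= e ->
  exists k b, open_side k b x /\ open_side k (~~ b) y.
Proof.
move=> far; have [n hn] : exists n, ~ `|coord n x - coord n y| <= e.
  by apply/existsNP => H; apply: far; exact: supdist_le.
move/negP: hn; rewrite -ltNge => hn.
(* the left bound is chosen first, so that room of width [e] is left for the
  right one *)
have gap a b : a + e < b -> exists p q : rat,
    [/\ wide_gap p q, a < ratr p & ratr q < b].
  move=> aeb; have [p] := @rat_in_itvoo R a (b - e) ltac:(lra).
  rewrite in_itv /= => /andP[ap pb].
  have [q] := @rat_in_itvoo R (ratr p + e) b ltac:(lra).
  rewrite in_itv /= => /andP[pq qb].
  by exists p, q; split=> //; exact: ltW.
have [xy|xy] := leP (coord n x) (coord n y).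
- have [|p [q [pq xp qy]]] := gap (coord n x) (coord n y).
    by move: hn; rewrite distrC ger0_norm ?subr_ge0//; lra.
  exists (pickle (n, p, q)), false; rewrite /open_side pickleK.
  by case: asboolP.
- have [|p [q [pq xp qy]]] := gap (coord n y) (coord n x).
    by move: hn; rewrite gtr0_norm ?subr_gt0//; lra.
  exists (pickle (n, p, q)), true; rewrite /open_side pickleK.
  by case: asboolP.
Qed.

(** The two sides of a gap are at distance at least [e], so [g] is far from one of
them. *)
Lemma side_away k (g : cube R) : exists b, forall x, closed_side k b x ->
  exists n, e / 2 <= `|coord n x - coord n g|.
Proof.
rewrite /closed_side; case: unpickle => [[[n p] q]|]; last by exists true.
case: asboolP => [|_]; last by exists true.
rewrite /wide_gap => pq.
have [gm|gm] := leP (coord n g) ((ratr p + ratr q) / 2).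
- exists true => x /= qx; exists n; apply: le_trans (ler_norm _); lra.
- exists false => x /= qx; exists n; rewrite distrC.
  by apply: le_trans (ler_norm _); lra.
Qed.

End gap.

End cube.

(** Along the branch of the tree that moves away from the [n]-th point of the dense
sequence at level [n], the cells have by compactness a common point in [A_z],
and no point of the sequence is within [e / 2] of it. *)
Lemma norm_separable_no_scheme (R : realType) d (Z : measurableType d)
    (A : set (Z * borel (cube R))) (e : R) :
  0 < e -> closed_sections (A : set (Z * cube R)) ->
  (forall z, norm_separable (xsection A z)) ->
  forall z u, ~ scheme (closed_side e) A z u.
Proof.
move=> e0 cA sepA z u su; have [D cD [DA dD]] := sepA z.
have [g Dg] := countable_sub_range point cD.
have /choice[child hchild] : forall nm : nat * nat, exists k,
    [/\ (k = nm.1.*2.+1 \/ k = nm.1.*2.+2),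
      cell (closed_side e) (u k) `<=` cell (closed_side e) (u nm.1) &
      forall x, cell (closed_side e) (u k) x ->
        exists n, e / 2 <= `|set_val (x n) - set_val (g nm.2 n)|].
  move=> [n m]; have [_ [p [u1 u2]]] := su n.
  have [[] hb] := side_away e p (g m).
    exists n.*2.+2; split; [by right|by rewrite u2 => x []|].
    by rewrite u2 => x [/hb].
  exists n.*2.+1; split; [by left|by rewrite u1 => x []|].
  by rewrite u1 => x [/hb].
pose fix node n := if n is m.+1 then child (node m, m) else 0%N.
have [|||x hx] := @compact_decreasing_bigcap _
  (fun n => xsection A z `&` cell (closed_side e) (u (node n))) (@compact_cube R).
- move=> n; apply: closedI; first exact: cA.
  by apply: closed_cell => p b; exact: closed_closed_side.
- move=> n; have [[[z' x] [Azx [_ ux]] /= zz'] _] := su (node n).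
  by exists x; split=> //; apply/xsectionP; rewrite -zz'.
- by move=> n; apply: setIS; case: (hchild (node n, n)).
have [Ax _] := hx 0%N I.
have [y Dy xy] := dD x Ax (e / 2) ltac:(lra).
have [n _ gn] := Dg y Dy.
have [_ ux] := hx n.+1 I.
have [_ _ /(_ x ux)[m]] := hchild (node n, n).
rewrite /= gn leNgt => /negP; apply.
by apply: le_lt_trans xy; exact: coord_dist_supdist.
Qed.

(** * Selectors *)

(** The measurable set [B] follows [C] where [C] has points and [A] elsewhere. *)
Lemma measurable_selection_extend d (Z : measurableType d) (T : ptopologicalType)
    (A C : set (Z * borel T)) :
  souslin Z -> souslin (borel T) -> compact [set: T] -> @second_countable T ->
  hausdorff_space T ->
  measurable A -> closed_sections (A : set (Z * T)) ->
  (forall z, xsection A z !=set0) ->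
  measurable C -> closed_sections (C : set (Z * T)) -> C `<=` A ->
  exists f : Z -> T, [/\ measurable_fun setT (f : Z -> borel T),
    forall z, A (z, f z) & forall z x, C (z, x) -> C (z, f z)].
Proof.
move=> sZ sT cT cntT hsT mA cA A0 mC cC CA.
have mprojC : measurable (fst @` C) by exact: measurable_proj.
pose B := C `|` (A `&` (~` (fst @` C) `*` setT)).
have [|||f [mf Bf]] := @measurable_selection _ _ _ sZ sT cT cntT hsT B.
- apply: measurableU => //; apply: measurableI => //.
  by apply: measurableX => //; exact: measurableC.
- move=> z; rewrite xsectionE preimage_setU -!xsectionE; apply: closedU => //.
  by apply: closed_sectionsI => //; apply: closed_sectionsX; exact: closedT.
- move=> z; have [[[z' x] Cx /= zz']|nCz] := pselect ((fst @` C) z).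
    by exists x; apply/xsectionP; left; rewrite -zz'.
  by have [x /xsectionP Ax] := A0 z; exists x; apply/xsectionP; right.
exists f; split=> // z => [|x Czx]; first by case: (Bf z) => [/CA//|[]].
by case: (Bf z) => // -[_ [nCz _]]; case: nCz; exists (z, x).
Qed.

Theorem proposition2 (R : realType) (d : measure_display)
    (Z : measurableType d) (hZ : standard_borel R Z)
    (A : set (Z * cube R))
    (mA : measurable (A : set (Z * borel (cube R))))
    (hne : forall z : Z, xsection A z !=set0)
    (hcompact : forall z : Z, compact (xsection A z))
    (hsep : forall z : Z, norm_separable (xsection A z)) :
  exists f : nat -> Z -> cube R,
    (forall n : nat, borel_selector A (f n)) /\
    (forall z : Z, norm_dense_in (xsection A z) (range (fun n => f n z))).
Proof.
have hsH : hausdorff_space (cube R) by exact: hausdorff_cube.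
have cptH : compact [set: cube R] by exact: compact_cube.
have cntH : @second_countable (cube R) by exact: compact_second_countable cptH.
have sH : souslin (borel (cube R)) by exact: compact_souslin_borel.
have sZ : souslin Z by exact: standard_borel_souslin hZ.
have cA : closed_sections A by move=> z; exact: compact_closed.
pose e k : R := k.+1%:R^-1.
have e0 k : 0 < e k by rewrite invr_gt0.
have /choice[C hC] k : coverable (open_side (e k)) A A.
  apply: (@countable_small_cover _ _ _ sZ sH cptH cntH (closed_side (e k))) => //.
  - exact: closed_closed_side.
  - exact: open_open_side.
  - exact: open_closed_side.
  - exact: norm_separable_no_scheme.
have sC k n : small (open_side (e k)) A (C k n) by case: (hC k).
have /choice[f hf] (kn : nat * nat) : exists f : Z -> cube R,
    [/\ measurable_fun setT (f : Z -> borel (cube R)), forall z, A (z, f z) &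
      forall z x, C kn.1 kn.2 (z, x) -> C kn.1 kn.2 (z, f z)].
  by have [mC cC CA _] := sC kn.1 kn.2; exact: measurable_selection_extend.
pose g m := f (odflt (0%N, 0%N) (unpickle m)).
exists g; split=> [m|z].
  by rewrite /g; case: (hf (odflt (0%N, 0%N) (unpickle m))).
split=> [_ [m _ <-]|x /xsectionP Azx r r0].
  by apply/xsectionP; rewrite /g; case: (hf (odflt (0%N, 0%N) (unpickle m))).
have [k] := @ltr_add_invr R 0 r r0; rewrite add0r -/(e k) => ekr.
have [_ /(_ _ Azx)[n _ Cx]] := hC k.
have [_ _ /(_ _ _ Cx) Cf] := hf (k, n).
exists (f (k, n) z).
  by exists (pickle (k, n)) => //; rewrite /g pickleK.
apply: le_lt_trans ekr; apply: contrapT => /far_sides[p [b [Vx Vf]]].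
by have [_ _ _ /(_ _ _ _ _ _ Cx Cf Vx)] := sC k n.
Qed.
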